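(* Let $\mathbb V$ be a linear space equipped with an $n$-linear map $f:\mathbb V\times\cdots\times\mathbb V\to\mathbb V$. For any basis $\mathcal B=\{e_i: i\in I\}$ of $\mathbb V$, the space $\mathbb V$ decomposes as the $f$-orthogonal direct sum of strongly $f$-invariant linear subspaces $$\mathbb V=\bigoplus_{[V_{[e_i]}]\in\mathcal F/\approx}\overbrace{V_{[e_i]}},$$ where the family $\mathcal F$, the equivalence relation $\approx$ and the subspaces $\overbrace{V_{[e_i]}}$ are those constructed from $f$ and $\mathcal B$ in the context.
   Context: Linear spaces are over an arbitrary field $\mathbb F$ and of arbitrary dimension; $n\ge 2$; $f:\mathbb V\times\cdots\times\mathbb V\to\mathbb V$ ($n$ factors) is $n$-linear. A superscript $(k)$ marks the $k$-th entry of $f$: $f(\mathbb V,\dots,W^{(k)},\dots,\mathbb V)$ is the span of all values of $f$ with $k$-th entry in $W$ and all other entries in $\mathbb V$, and $f(\mathbb V,\dots,V_1^{(k_1)},\dots,V_2^{(k_2)},\dots,\mathbb V)$ is the span of all values with $k_1$-th entry in $V_1$, $k_2$-th entry in $V_2$ and the other entries in $\mathbb V$. Subspaces $V_1,V_2$ are $f$-orthogonal if $f(\mathbb V,\dots,V_1^{(i)},\dots,V_2^{(j)},\dots,\mathbb V)=0$ for all $i\ne j$ in $\{1,\dots,n\}$. A direct sum decomposition $\mathbb V=\bigoplus_{j\in J}V_j$ is $f$-orthogonal if $V_j,V_k$ are $f$-orthogonal whenever $j\neq k$. A subspace $W$ is strongly $f$-invariant if $f(\mathbb V,\dots,W^{(i)},\dots,\mathbb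 V)\subset W$ for all $i\in\{1,\dots,n\}$. Construction from a basis $\mathcal B$. For each $e\in\mathcal B$ introduce a symbol $\overline e\notin\mathcal B$; $\overline{\mathcal B}=\{\overline e:e\in\mathcal B\}$, $\overline{(\overline e)}:=e$. Let $\mathbb V^*=\mathbb V\setminus\{0\}$ and $\mathcal P(\mathbb V^* )$ its power set. Define $F:\mathcal P(\mathbb V^* )\times(\mathcal B\dot\cup\overline{\mathcal B})^{n-1}\to\mathcal P(\mathbb V^* )$ as follows: $F(\emptyset,\dots)=\emptyset$; for $U\ne\emptyset$ and $\xi_1,\dots,\xi_{n-1}\in\mathcal B$, $$F(U,\xi_1,\dots,\xi_{n-1})=\Big(\bigcup_{1\le k\le n,\ \sigma\in\mathbb S_{n-1}}\{f(\xi_{\sigma(1)},\dots,u^{(k)},\dots,\xi_{\sigma(n-1)}):u\in U\}\Big)\setminus\{0\},$$ $$F(U,\overline\xi_1,\dots,\overline\xi_{n-1})=\Big(\bigcup_{1\le k\le n,\ \sigma\in\mathbb S_{n-1}}\{u\in\mathbb V:f(\xi_{\sigma(1)},\dots,u^{(k)},\dots,\xi_{\sigma(n-1)})\in U\}\Big)\setminus\{0\},$$ where $u$ is in the $k$-th entry and the remaining entries are filled in order by $\xi_{\sigma(1)},\dots,\xi_{\sigma(n-1)}$; and $F(U,\dots)=\emptyset$ if among the last $n-1$ arguments there is one in $\mathcal B$ and one in $\overline{\mathcal B}$. $e_i\in\mathcal B$ is connected to $e_j\in\mathcal B$ (written $e_i\sim e_j$) if $e_i=e_j$ or there is an ordered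 list $(X_1,\dots,X_m)$, $m\ge1$, of $(n-1)$-tuples $X_r\in(\mathcal B\dot\cup\overline{\mathcal B})^{n-1}$ such that $F(\{e_i\},X_1)\ne\emptyset$, $F(F(\{e_i\},X_1),X_2)\neq\emptyset$, ..., $F(\dots F(F(\{e_i\},X_1),X_2)\dots,X_{m-1})\ne\emptyset$ and $e_j\in F(F(\dots F(F(\{e_i\},X_1),X_2)\dots,X_{m-1}),X_m)$. This is an equivalence relation on $\mathcal B$; $[e_i]$ is the class of $e_i$, $V_{[e_i]}:=\bigoplus_{e_j\in[e_i]}\mathbb F e_j$, so $\mathbb V=\bigoplus_{[e_i]\in\mathcal B/\sim}V_{[e_i]}$, and $\Pi_{V_{[e_i]}}:\mathbb V\to V_{[e_i]}$ is the associated projection. Let $\mathcal F=\{V_{[e_i]}:[e_i]\in\mathcal B/\sim\}$. Put $V_{[e_i]}\approx V_{[e_j]}$ iff $V_{[e_i]}=V_{[e_j]}$ or there is $\{[\xi_1],\dots,[\xi_m]\}\subset\mathcal B/\sim$ with $[\xi_1]=[e_i]$, $[\xi_m]=[e_j]$ and, for each $r=1,\dots,m-1$, $$\sum_{1\le k_1<k_2\le n}\Big[\Pi_{V_{[\xi_r]}}\big(f(\mathbb V,\dots,V_{[\xi_{r+1}]}^{(k_1)},\dots,V_{[\xi_{r+1}]}^{(k_2)},\dots,\mathbb V)\big)+\Pi_{V_{[\xi_{r+1}]}}\big(f(\mathbb V,\dots,V_{[\xi_r]}^{(k_1)},\dots,V_{[\xi_r]}^{(k_2)},\dots,\mathbb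 V)\big)\Big]\ne0$$ (a sum of linear subspaces). This is an equivalence relation on $\mathcal F$; $[V_{[e_i]}]$ denotes the class of $V_{[e_i]}$, and $\overbrace{V_{[e_i]}}:=\bigoplus_{V_{[e_j]}\in[V_{[e_i]}]}V_{[e_j]}$. *)

(* Defs.v *)
From HB Require Import structures.
From mathcomp Require Import all_boot all_order all_fingroup all_algebra.
From mathcomp Require Import boolp classical_sets functions cardinality fsbigop.

Set Implicit Arguments.
Unset Strict Implicit.
Unset Printing Implicit Defensive.

Import GRing.Theory.

Local Open Scope classical_set_scope.
Local Open Scope ring_scope.

Definition is_subspace (F : fieldType) (V : lmodType F) (W : set V) : Prop :=
  W 0 /\ forall (a : F) (x y : V), W x -> W y -> W (a *: x + y).

Definition span (F : fieldType) (V : lmodType F) (S : set V) : set V :=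
  smallest (@is_subspace F V) S.

Definition linearly_independent (F : fieldType) (V : lmodType F)
    (B : set V) : Prop :=
  forall (s : seq V) (c : V -> F),
    uniq s -> (forall v, v \in s -> B v) ->
    \sum_(v <- s) c v *: v = 0 -> forall v, v \in s -> c v = 0.

Definition is_basis (F : fieldType) (V : lmodType F) (B : set V) : Prop :=
  linearly_independent B /\ span B = [set: V].

Definition subspace_add (F : fieldType) (V : lmodType F)
    (W1 W2 : set V) : set V :=
  [set x + y | x in W1 & y in W2].

Definition subspace_sum (F : fieldType) (V : lmodType F) (T : Type)
    (J : set T) (W : T -> set V) : set V :=
  span (\bigcup_(j in J) W j).

(* The family x writes v as a finite sum of vectors x j of W j, j in J.
   Outside J it is required to vanish, so that it can be unique. *)
Definition decomposes (F : fieldType) (V : lmodType F) (T : choiceType)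
    (J : set T) (W : T -> set V) (v : V) (x : T -> V) : Prop :=
  [/\ forall j, J j -> W j (x j),
      forall j, ~ J j -> x j = 0,
      finite_set [set j | x j <> 0]
    & \sum_(j \in J) x j = v].

Definition is_direct_sum (F : fieldType) (V : lmodType F) (T : choiceType)
    (J : set T) (W : T -> set V) : Prop :=
  (forall j, J j -> is_subspace (W j)) /\
  forall v : V, exists! x : T -> V, decomposes J W v x.

(* Projection onto W j along the other summands; it is meaningful only when
   is_direct_sum J W holds. *)
Definition projection (F : fieldType) (V : lmodType F) (T : choiceType)
    (J : set T) (W : T -> set V) (j : T) (v : V) : V :=
  xget (fun=> 0) [set x : T -> V | decomposes J W v x] j.

Definition eq_class (T : Type) (D : set T) (R : T -> T -> Prop) (x : T) :
    set T :=
  [set y | D y /\ R x y].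

Definition quotient_set (T : Type) (D : set T) (R : T -> T -> Prop) :
    set (set T) :=
  [set eq_class D R x | x in D].

(* The n-tuple with u in entry k, whose other entries are those of w in order. *)
Definition insert_at (T : Type) (n : nat) (k : 'I_n) (u : T)
    (w : 'I_n.-1 -> T) : {ffun 'I_n -> T} :=
  [ffun j => if unlift k j is Some i then w i else u].

Definition multilinear (F : fieldType) (V : lmodType F) (n : nat)
    (f : {ffun 'I_n -> V} -> V) : Prop :=
  forall (k : 'I_n) (w : 'I_n.-1 -> V), linear (fun u => f (insert_at k u w)).

Definition span1 (F : fieldType) (V : lmodType F) (n : nat)
    (f : {ffun 'I_n -> V} -> V) (k : 'I_n) (W : set V) : set V :=
  span [set f v | v in [set v : {ffun 'I_n -> V} | W (v k)]].

Definition span2 (F : fieldType) (V : lmodType F) (n : nat)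
    (f : {ffun 'I_n -> V} -> V) (k1 : 'I_n) (W1 : set V)
    (k2 : 'I_n) (W2 : set V) : set V :=
  span [set f v | v in [set v : {ffun 'I_n -> V} | W1 (v k1) /\ W2 (v k2)]].

Definition f_orthogonal (F : fieldType) (V : lmodType F) (n : nat)
    (f : {ffun 'I_n -> V} -> V) (W1 W2 : set V) : Prop :=
  forall i j : 'I_n, i <> j -> span2 f i W1 j W2 = [set 0].

Definition f_orthogonal_direct_sum (F : fieldType) (V : lmodType F) (n : nat)
    (f : {ffun 'I_n -> V} -> V) (T : choiceType)
    (J : set T) (W : T -> set V) : Prop :=
  is_direct_sum J W /\
  forall j k, J j -> J k -> j <> k -> f_orthogonal f (W j) (W k).

Definition strongly_invariant (F : fieldType) (V : lmodType F) (n : nat)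
    (f : {ffun 'I_n -> V} -> V) (W : set V) : Prop :=
  forall i : 'I_n, span1 f i W `<=` W.

(* inl e stands for e itself and inr e for its barred copy. *)
Definition symbol (V : Type) (B : set V) : Type :=
  (set_type B + set_type B)%type.

(* For n >= 2 at most one alternative applies, and none does when X mixes plain
   and barred symbols: the value is then empty.  It is also empty when U is. *)
Definition Fmap (F : fieldType) (V : lmodType F) (n : nat)
    (f : {ffun 'I_n -> V} -> V) (B : set V)
    (U : set V) (X : 'I_n.-1 -> symbol B) : set V :=
  [set v | v <> 0 /\
    ((exists2 xi : 'I_n.-1 -> set_type B, (forall j, X j = inl (xi j)) &
        exists (k : 'I_n) (s : 'S_n.-1),
        exists2 u, U u & f (insert_at k u (fun j => val (xi (s j)))) = v)
     \/
     (exists2 xi : 'I_n.-1 -> set_type B, (forall j, X j = inr (xi j)) &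
        exists (k : 'I_n) (s : 'S_n.-1),
        U (f (insert_at k v (fun j => val (xi (s j)))))))].

Definition connected (F : fieldType) (V : lmodType F) (n : nat)
    (f : {ffun 'I_n -> V} -> V) (B : set V) (e e' : V) : Prop :=
  e = e' \/
  exists Xs : seq ('I_n.-1 -> symbol B),
    [/\ (0 < size Xs)%N,
        forall r, (0 < r < size Xs)%N ->
          foldl (Fmap f (B:=B)) [set e] (take r Xs) !=set0
      & foldl (Fmap f (B:=B)) [set e] Xs e'].

Definition basis_classes (F : fieldType) (V : lmodType F) (n : nat)
    (f : {ffun 'I_n -> V} -> V) (B : set V) : set (set V) :=
  quotient_set B (connected f B).

(* The subspace V_c attached to a class c of basis vectors. *)
Definition Vclass (F : fieldType) (V : lmodType F) (c : set V) : set V :=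
  subspace_sum c (fun e => span [set e]).

Definition Vproj (F : fieldType) (V : lmodType F) (n : nat)
    (f : {ffun 'I_n -> V} -> V) (B : set V) (c : set V) (v : V) : V :=
  projection (basis_classes f B) (@Vclass F V) c v.

Definition Vfamily (F : fieldType) (V : lmodType F) (n : nat)
    (f : {ffun 'I_n -> V} -> V) (B : set V) : set (set V) :=
  [set Vclass c | c in basis_classes f B].

Definition linked (F : fieldType) (V : lmodType F) (n : nat)
    (f : {ffun 'I_n -> V} -> V) (B : set V) (c d : set V) : Prop :=
  subspace_sum [set k : 'I_n * 'I_n | (k.1 < k.2)%N]
    (fun k => subspace_add
       (Vproj f B c @` span2 f k.1 (Vclass d) k.2 (Vclass d))
       (Vproj f B d @` span2 f k.1 (Vclass c) k.2 (Vclass c)))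
  <> [set 0].

Definition approx (F : fieldType) (V : lmodType F) (n : nat)
    (f : {ffun 'I_n -> V} -> V) (B : set V) (W W' : set V) : Prop :=
  W = W' \/
  exists (m : nat) (xi : nat -> set V),
    [/\ forall r, (r <= m)%N -> basis_classes f B (xi r),
        Vclass (xi 0%N) = W,
        Vclass (xi m) = W'
      & forall r, (r < m)%N -> linked f B (xi r) (xi r.+1)].

Definition approx_classes (F : fieldType) (V : lmodType F) (n : nat)
    (f : {ffun 'I_n -> V} -> V) (B : set V) : set (set (set V)) :=
  quotient_set (Vfamily f B) (approx f B).

(* The overbraced subspace attached to a class C of members of the family. *)
Definition overbrace (F : fieldType) (V : lmodType F) (C : set (set V)) :
    set V :=
  subspace_sum C id.

(* Main.v *)
From mathcomp Require Import all_boot all_order all_fingroup all_algebra.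
From mathcomp Require Import boolp classical_sets functions cardinality fsbigop.
Require Import Defs.

(** Everything is read off from the values of f on tuples of basis vectors.

    If e_1, ..., e_n are basis vectors and v = f (e_1, ..., e_n) is nonzero,
    then v is reached from e_i by one step of the construction, and any e_j is
    reached from v by one barred step, so all the e_i lie in a single connection
    class (connected_of_value_neq0).  If moreover the basis vector e' occurs in
    the expansion of v, then the projection of v to the subspace of the class of
    e' is nonzero; as n is at least 2, two entries of f lie in the subspace of
    the class of the e_i, so the two classes are linked (linked_of_value).

    Label each basis vector e by the class brace_of e for approx of the
    subspace of its connection class.  The overbraced subspaces are the spans
    of the sets of basis vectors with a common label (overbrace_labelled), and
    grouping a basis by labels always yields a direct sum
    (labelled_direct_sum).  By the first remark a nonzero value of f on basis
    vectors has all its entries under the same label, which is orthogonality;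
    by the second one that value only involves basis vectors with this label,
    which is strong invariance.  Multilinearity extends both facts from basis
    vectors to their spans (multilinear_span).

    The labels are meaningful because connection and approx are equivalence
    relations.  A single step of the construction is reversed by exchanging
    plain and barred symbols (Fmap_swap_bar), which gives the symmetry of
    connection; chains for approx can be glued because a class is determined by
    its span (Vclass_inj). *)

Set Implicit Arguments.
Unset Strict Implicit.
Unset Printing Implicit Defensive.

Import GRing.Theory.

Local Open Scope classical_set_scope.
Local Open Scope ring_scope.

(** * Spans *)
Section Span.
Variables (F : fieldType) (V : lmodType F).
Implicit Types (A W : set V).

Lemma span_subspace A : is_subspace (span A).
Proof.
split=> [W [[W0 _] _] //|a x y Ax Ay W WP].
by have [[_ Wlin] _] := WP; apply: Wlin; [apply: Ax|apply: Ay].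
Qed.

Lemma sub_span A : A `<=` span A.
Proof. exact: sub_gen_smallest. Qed.

Lemma span_sub A W : is_subspace W -> A `<=` W -> span A `<=` W.
Proof. exact: smallest_sub. Qed.

Lemma eq_span A A' : A `<=` span A' -> A' `<=` span A -> span A = span A'.
Proof.
by move=> AA' A'A; apply/seteqP; split; apply: span_sub => //;
  apply: span_subspace.
Qed.

Lemma subspace_sumr W (I : Type) (s : seq I) (P : pred I) (x : I -> V) :
  is_subspace W -> (forall i, P i -> W (x i)) -> W (\sum_(i <- s | P i) x i).
Proof.
move=> [W0 Wlin] Wx; elim/big_ind: _ => // u v Wu Wv.
by rewrite -[u]scale1r; apply: Wlin.
Qed.

Lemma subspace_set0 : is_subspace [set 0 : V].
Proof. by split=> // a x y -> ->; rewrite scaler0 addr0. Qed.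

End Span.

(** * Coordinates in a basis *)
Section Coordinates.
Variables (F : fieldType) (V : lmodType F) (B : set V).
Implicit Types (v w : V) (a b : V -> F).

(** The finite support is kept as an existential list so that two expansions can
    be brought to a common list of vectors before being compared. *)
Definition expansion v a : Prop := exists s : seq V,
  [/\ uniq s, (forall e, e \in s -> B e), (forall e, e \notin s -> a e = 0)
    & \sum_(e <- s) a e *: e = v].

Definition coordinate v : V -> F := xget (fun=> 0) [set a | expansion v a].

Lemma big_vanish (s t : seq V) a : uniq s -> uniq t -> {subset s <= t} ->
  (forall e, e \notin s -> a e = 0) ->
  \sum_(e <- t) a e *: e = \sum_(e <- s) a e *: e.
Proof.
move=> us ut st as0; rewrite (bigID (mem s)) /= [X in _ + X]big1 ?addr0.
  rewrite -big_filter; apply/perm_big/uniq_perm => //; first exact: filter_uniq.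
  by move=> e; rewrite mem_filter; case: (boolP (e \in s)) => //= /st ->.
by move=> e /as0 ->; rewrite scale0r.
Qed.

Lemma expansion_lin k v w a b : expansion v a -> expansion w b ->
  expansion (k *: v + w) (fun e => k * a e + b e).
Proof.
move=> [s [us sB as0 <-]] [t [ut tB bt0 <-]].
pose r := undup (s ++ t).
have ur : uniq r by exact: undup_uniq.
have sr : {subset s <= r} by move=> e es; rewrite mem_undup mem_cat es.
have tr : {subset t <= r} by move=> e et; rewrite mem_undup mem_cat et orbT.
exists r; split=> //.
- by move=> e; rewrite mem_undup mem_cat => /orP[/sB|/tB].
- move=> e; rewrite mem_undup mem_cat negb_or => /andP[/as0-> /bt0->].
  by rewrite mulr0 addr0.
rewrite -(big_vanish us ur sr as0) -(big_vanish ut ur tr bt0).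
rewrite scaler_sumr -big_split /=; apply: eq_bigr => e _.
by rewrite scalerDl scalerA.
Qed.

Lemma expansion0 : expansion 0 (fun=> 0).
Proof. by exists [::]; split=> //; rewrite big_nil. Qed.

Lemma expansion_basis e : B e -> expansion e (fun e' => (e' == e)%:R).
Proof.
move=> Be; exists [:: e]; split=> //.
- by move=> e'; rewrite inE => /eqP->.
- by move=> e'; rewrite inE => /negPf->.
by rewrite big_seq1 eqxx scale1r.
Qed.

Lemma big_expansion (I : Type) (s : seq I) (x : I -> V) (a : I -> V -> F) :
  (forall i, expansion (x i) (a i)) ->
  expansion (\sum_(i <- s) x i) (fun e => \sum_(i <- s) a i e).
Proof.
move=> xa; elim: s => [|i s IHs].
  rewrite big_nil (_ : (fun=> _) = fun=> 0); first exact: expansion0.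
  by apply/funext => e; rewrite big_nil.
rewrite big_cons -[x i]scale1r.
rewrite (_ : (fun=> _) = fun e => 1 * a i e + \sum_(j <- s) a j e).
  exact: expansion_lin.
by apply/funext => e; rewrite big_cons mul1r.
Qed.

Hypothesis hB : is_basis B.

Lemma expansion_exists v : exists a, expansion v a.
Proof.
have [_ spanB] := hB; have : span B v by rewrite spanB.
move: v; apply: span_sub => [|e Be]; last by eexists; exact: expansion_basis.
split; first by eexists; exact: expansion0.
move=> k x y [a xa] [b yb]; by eexists; exact: (expansion_lin k xa yb).
Qed.

Lemma expansion_uniq v a b : expansion v a -> expansion v b -> a = b.
Proof.
move=> va vb; have [s [us sB s0 sumE]] := expansion_lin (-1) va vb.
rewrite scaleN1r addNr in sumE; have [li _] := hB.
apply/funext => e; apply/esym/eqP; rewrite -subr_eq0 addrC -mulN1r; apply/eqP.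
by case: (boolP (e \in s)) => [/(li s _ us sB sumE)|/s0].
Qed.

Lemma coordinateP v : expansion v (coordinate v).
Proof. exact: (xgetPex _ (expansion_exists v)). Qed.

Lemma coordinateE v a : expansion v a -> coordinate v = a.
Proof. exact/expansion_uniq/coordinateP. Qed.

Lemma coordinate_lin k v w e :
  coordinate (k *: v + w) e = k * coordinate v e + coordinate w e.
Proof.
by rewrite (coordinateE (expansion_lin k (coordinateP v) (coordinateP w))).
Qed.

Lemma coordinate0 e : coordinate 0 e = 0.
Proof. by rewrite (coordinateE expansion0). Qed.

Lemma coordinate_basis e e' : B e -> coordinate e e' = (e' == e)%:R.
Proof. by move=> Be; rewrite (coordinateE (expansion_basis Be)). Qed.

Lemma coordinate_sum (I : Type) (s : seq I) (x : I -> V) e :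
  coordinate (\sum_(i <- s) x i) e = \sum_(i <- s) coordinate (x i) e.
Proof.
by rewrite (coordinateE (big_expansion s (fun i => coordinateP (x i)))).
Qed.

Lemma coordinate_neq0 v e : coordinate v e <> 0 -> B e.
Proof.
have [s [_ sB s0 _]] := coordinateP v.
by case: (boolP (e \in s)) => [/sB//|/s0].
Qed.

(** Coordinates turn equalities between vectors, in particular between the
    components of a direct sum, into pointwise statements about scalars. *)
Lemma coordinate_inj v w : (forall e, coordinate v e = coordinate w e) -> v = w.
Proof.
move=> vw; have [s [us _ s0 <-]] := coordinateP v.
have [t [ut _ t0 <-]] := coordinateP w.
have ur := undup_uniq (s ++ t).
rewrite -(big_vanish us ur _ s0) => [|e es]; last by rewrite mem_undup mem_cat es.
rewrite -(big_vanish ut ur _ t0) => [|e et].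
  by apply: eq_bigr => e _; rewrite vw.
by rewrite mem_undup mem_cat et orbT.
Qed.

Lemma basis_neq0 e : B e -> e <> 0.
Proof.
move=> Be e0; have /eqP := coordinate_basis e Be.
by rewrite eqxx {1}e0 coordinate0 eq_sym oner_eq0.
Qed.

(** Membership in the span of part of the basis becomes a condition on the
    support of the coordinates; the direct sums below rest on it. *)
Lemma span_coordinate (S : set V) v : S `<=` B ->
  span S v <-> forall e, coordinate v e <> 0 -> S e.
Proof.
move=> SB; split=> [|vS].
  move: v; apply: span_sub => [|e Se e'].
    split=> [e|k x y xS yS e]; first by rewrite coordinate0.
    rewrite coordinate_lin.
    have [-> h|/eqP/xS//] := eqVneq (coordinate x e) 0.
    by apply: yS => h'; apply: h; rewrite h' mulr0 addr0.
  by rewrite (coordinate_basis _ (SB _ Se)); case: eqP => // ->.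
have [s [_ _ _ <-]] := coordinateP v.
apply: subspace_sumr => [|e _]; first exact: span_subspace.
have [S0 Slin] := span_subspace S.
have [->|/eqP/vS Se] := eqVneq (coordinate v e) 0; first by rewrite scale0r.
by rewrite -[_ *: _]addr0; apply: Slin => //; exact: sub_span.
Qed.

Lemma span_basis_mem (S : set V) e : S `<=` B -> B e -> span S e -> S e.
Proof.
move=> SB Be /(span_coordinate _ SB) /(_ e); apply.
by rewrite coordinate_basis // eqxx; apply/eqP/oner_neq0.
Qed.

Lemma coordinate_restrict (P : pred V) v :
  exists w, forall e, coordinate w e = if P e then coordinate v e else 0.
Proof.
have [s [us sB s0 _]] := coordinateP v.
pose a e := if P e then coordinate v e else 0.
exists (\sum_(e <- s) a e *: e) => e.
rewrite (@coordinateE _ a) //; exists s; split=> // e'.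
by rewrite /a => /s0 ->; case: ifP.
Qed.

End Coordinates.

(** * Direct sums obtained by labelling a basis *)

(** The label g e of a basis vector e names the summand that contains it.  The
    subspaces of the connection classes and the overbraced subspaces are both of
    this form, with different labels. *)
Section Labelling.
Variables (F : fieldType) (V : lmodType F) (B : set V) (hB : is_basis B).
Variables (T : choiceType) (J : set T) (W : T -> set V) (g : V -> T).
Hypothesis gJ : forall e, B e -> J (g e).
Hypothesis WE : forall j, J j -> W j = span [set e | B e /\ g e = j].

Let c := coordinate B.

Lemma labelled_subspaceP j v : J j ->
  W j v <-> forall e, c v e <> 0 -> g e = j.
Proof.
move=> Jj; rewrite WE // (span_coordinate hB) //; last by move=> e [].
split=> h e ve; first by have [] := h e ve.
by split; [exact: coordinate_neq0 hB _ _ ve | exact: h].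
Qed.

Lemma coordinate_labelled_sum (r : seq T) (x : T -> V) e : uniq r ->
  (forall j, j \notin r -> x j = 0) ->
  (forall j e, c (x j) e <> 0 -> g e = j) ->
  c (\sum_(j <- r) x j) e = c (x (g e)) e.
Proof.
move=> ur xr xg; rewrite /c coordinate_sum //.
have other j : j != g e -> c (x j) e = 0.
  by move=> jg; apply: contrapT => /xg gj; rewrite gj eqxx in jg.
case: (boolP (g e \in r)) => [gr|gr].
  by rewrite (bigD1_seq (g e)) //= big1 ?addr0.
rewrite xr // coordinate0 // big1_seq // => j /= jr; apply: other.
by apply: contraNneq gr => <-.
Qed.

Lemma fsbig_support (x : T -> V) : (forall j, ~ J j -> x j = 0) ->
  finite_set [set j | x j <> 0] ->
  exists r : seq T, [/\ uniq r, (forall j, j \notin r -> x j = 0)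
    & \sum_(j \in J) x j = \sum_(j <- r) x j].
Proof.
move=> xJ /finite_seqP[s sE]; exists (undup s).
have xs j : j \notin s -> x j = 0.
  by move=> js; apply: contrapT => xj; move/negP: js; apply;
    have : [set` s] j by rewrite -sE.
split; rewrite ?undup_uniq //; first by move=> j; rewrite mem_undup; exact: xs.
rewrite -(fsbig_widen [set` undup s] J).
- by rewrite -fsbig_seq ?undup_uniq.
- move=> j /=; rewrite mem_undup => js; apply: contrapT => /xJ.
  by have : [set` s] j by []; rewrite -sE.
- by move=> j [_ /= /negP]; rewrite mem_undup => /xs.
Qed.

(** The components of v are obtained by cutting its coordinates according to
    the labels.  This determines them, so existence and uniqueness of the
    decomposition and the value of the projections all follow. *)
Lemma decomposes_labelledP v x :
  decomposes J W v x <->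
  forall j e, c (x j) e = if g e == j then c v e else 0.
Proof.
split=> [[xW xJ xfin xsum] j e|xE].
  have xg j' e' : c (x j') e' <> 0 -> g e' = j'.
    move=> xe; have Jj : J j'.
      by apply: contrapT => /xJ xj; apply: xe; rewrite xj /c coordinate0.
    by move: e' xe; apply/labelled_subspaceP => //; apply: xW.
  have [r [ur xr rsum]] := fsbig_support xJ xfin.
  case: eqP => [<-|gj]; last by apply: contrapT => /xg.
  by rewrite -xsum rsum coordinate_labelled_sum.
have xg j e : c (x j) e <> 0 -> g e = j by rewrite xE; case: eqP.
have xJ j : ~ J j -> x j = 0.
  move=> Jj; apply: (coordinate_inj hB) => e; rewrite (coordinate0 hB) -/c xE.
  case: eqP => // gj; apply: contrapT => /(coordinate_neq0 hB) /gJ.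
  by rewrite gj.
have xfin : finite_set [set j | x j <> 0].
  have [s [_ _ s0 _]] := coordinateP hB v.
  apply: (@sub_finite_set _ _ [set` map g s]) => // j /= xj.
  apply: contrapT => js; apply: xj; apply: (coordinate_inj hB) => e.
  rewrite (coordinate0 hB) -/c xE; case: eqP => // gj.
  by apply: s0; apply/negP => es; apply: js; rewrite -gj map_f.
split=> //.
  by move=> j Jj; apply/labelled_subspaceP => // e; exact: xg.
have [r [ur xr ->]] := fsbig_support xJ xfin.
apply: (coordinate_inj hB) => e.
by rewrite -/c coordinate_labelled_sum // xE eqxx.
Qed.

Lemma labelled_direct_sum : is_direct_sum J W.
Proof.
split=> [j Jj|v]; first by rewrite WE //; exact: span_subspace.
pose P j (w : V) := forall e, c w e = if g e == j then c v e else 0.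
have /choice[x xP] : forall j, exists w, P j w.
  by move=> j; exact: (coordinate_restrict hB (fun e => g e == j) v).
exists x; split=> [|y /decomposes_labelledP yP]; first exact/decomposes_labelledP.
apply/funext => j; apply: (coordinate_inj hB) => e.
by rewrite -/c xP yP.
Qed.

Lemma coordinate_projection j v e :
  c (projection J W j v) e = if g e == j then c v e else 0.
Proof.
have [_ /(_ v)[x [xP _]]] := labelled_direct_sum.
exact: (decomposes_labelledP v _).1 (xgetPex _ (ex_intro _ x xP)) j e.
Qed.

End Labelling.

(** * Classes of an equivalence relation on a set *)
Section EquivalenceClasses.
Variables (T : Type) (D : set T) (R : T -> T -> Prop).
Hypothesis Rrefl : forall x, D x -> R x x.
Hypothesis Rsym : forall x y, D x -> D y -> R x y -> R y x.
Hypothesis Rtrans : forall x y z, D x -> D y -> D z -> R x y -> R y z -> R x z.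

Lemma eq_class_eqP x y : D x -> D y ->
  eq_class D R x = eq_class D R y <-> R x y.
Proof.
move=> Dx Dy; split=> [xy|xy].
  have : eq_class D R y y by split=> //; exact: Rrefl.
  by rewrite -xy => -[].
apply/seteqP; split=> z [Dz Rz]; split=> //.
  by apply: (Rtrans Dy Dx Dz) => //; exact: Rsym.
exact: (Rtrans Dx Dy Dz).
Qed.

End EquivalenceClasses.

(** * Multilinear maps on spans *)
Section Multilinear.
Variables (F : fieldType) (V : lmodType F) (n : nat).

Lemma insert_at_lift (k : 'I_n) (v : {ffun 'I_n -> V}) :
  insert_at k (v k) (fun i => v (lift k i)) = v.
Proof. by apply/ffunP => j; rewrite ffunE; case: unliftP => [i ->|->]. Qed.

Variables (f : {ffun 'I_n -> V} -> V) (hf : multilinear f).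

Lemma multilinear_preimage_subspace (k : 'I_n) (w : 'I_n.-1 -> V) (N : set V) :
  is_subspace N -> is_subspace [set u | N (f (insert_at k u w))].
Proof.
move=> [N0 Nlin]; split=> [|a x y Nx Ny] /=; last by rewrite hf; exact: Nlin.
have := hf k w (-1) 0 0.
by rewrite scaler0 addr0 scaleN1r addNr => ->.
Qed.

(** The entries are moved from S i to its span one at a time: for fixed other
    entries, the vectors that f sends into N form a subspace. *)
Lemma multilinear_span (N : set V) (S : 'I_n -> set V) : is_subspace N ->
  (forall e : {ffun 'I_n -> V}, (forall i, S i (e i)) -> N (f e)) ->
  forall v : {ffun 'I_n -> V}, (forall i, span (S i) (v i)) -> N (f v).
Proof.
move=> Nsub NS.
(* In the induction the entries of index below m already range over spans. *)
suff IH m (v : {ffun 'I_n -> V}) :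
    (forall i : 'I_n, if (i < m)%N then span (S i) (v i) else S i (v i)) ->
    N (f v).
  by move=> v vS; apply: (IH n) => i; rewrite ltn_ord.
elim: m v => [|m IHm] v vS; first by apply: NS => i; exact: vS.
have [mn|nm] := ltnP m n; last first.
  apply: IHm => i; have im : (i < m)%N := leq_trans (ltn_ord i) nm.
  by have := vS i; rewrite im ltnS ltnW.
pose k := Ordinal mn; rewrite -(insert_at_lift k v).
have := vS k; rewrite ltnS leqnn /=.
move: (v k); apply: span_sub; first exact: multilinear_preimage_subspace.
move=> u Su /=; apply: IHm => i; rewrite ffunE.
case: unliftP => [j ij|->]; last by rewrite ltnn.
have := vS i; rewrite -ij ltnS leq_eqVlt.
by have := neq_lift k j; rewrite -ij eq_sym -val_eqE => /negPf ->.
Qed.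

End Multilinear.

(** * Connection of basis vectors *)
Section Connection.
Variables (F : fieldType) (V : lmodType F) (n : nat).
Variables (f : {ffun 'I_n -> V} -> V) (B : set V).
Implicit Types (U : set V) (X : 'I_n.-1 -> symbol B).

Definition swap_bar X : 'I_n.-1 -> symbol B :=
  fun j => match X j with inl e => inr e | inr e => inl e end.

(** The construction acts on sets pointwise, so a chain of nonempty sets that
    ends with e' amounts to a chain of single vectors. *)
Lemma Fmap_point U X v :
  Fmap f U X v <-> exists2 u, U u & Fmap f [set u] X v.
Proof.
split.
  move=> [v0 [[xi Xxi [k [s [u Uu fu]]]]|[xi Xxi [k [s Uv]]]]].
    by exists u => //; split=> //; left; exists xi => //; exists k, s, u.
  by eexists; first exact: Uv; split=> //; right; exists xi => //; exists k, s.
move=> [u Uu [v0 [[xi Xxi [k [s [_ -> fu]]]]|[xi Xxi [k [s fv]]]]]].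
  by split=> //; left; exists xi => //; exists k, s, u.
by split=> //; right; exists xi => //; exists k, s; rewrite fv.
Qed.

(** The plain clause for (u, v) and the barred clause for (v, u) are the same
    equation f (.., u, ..) = v, with the same position and permutation. *)
Lemma Fmap_swap_bar X u v : u <> 0 ->
  Fmap f [set u] X v -> Fmap f [set v] (swap_bar X) u.
Proof.
move=> u0 [v0 [[xi Xxi [k [s [_ -> fu]]]]|[xi Xxi [k [s fv]]]]]; split=> //.
  by right; exists xi => [j|]; [rewrite /swap_bar Xxi | exists k, s].
by left; exists xi => [j|]; [rewrite /swap_bar Xxi | exists k, s, v].
Qed.

Lemma foldl_Fmap_mono U U' (Xs : seq ('I_n.-1 -> symbol B)) : U `<=` U' ->
  foldl (Fmap f (B:=B)) U Xs `<=` foldl (Fmap f (B:=B)) U' Xs.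
Proof.
elim: Xs U U' => //= X Xs IHXs U U' UU'; apply: IHXs => v.
by move=> /Fmap_point[u /UU' Uu uv]; apply/Fmap_point; exists u.
Qed.

Lemma foldl_Fmap_set0 (Xs : seq ('I_n.-1 -> symbol B)) :
  foldl (Fmap f (B:=B)) set0 Xs = set0.
Proof.
elim: Xs => //= X Xs; rewrite (_ : Fmap f set0 X = set0) //.
by apply/seteqP; split=> // v /Fmap_point[].
Qed.

(** The empty set only produces the empty set, so the intermediate sets of a
    chain that ends with e' are nonempty; the empty chain accounts for
    equality. *)
Lemma connectedE e e' :
  connected f B e e' <->
  exists Xs, foldl (Fmap f (B:=B)) [set e] Xs e'.
Proof.
split=> [[<-|[Xs [_ _ ?]]]|[Xs Xse']]; [by exists [::]|by exists Xs|].
case: Xs Xse' => [->|X Xs Xse']; [by left|right; exists (X :: Xs)].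
split=> // r _; apply/set0P/eqP => r0; move: Xse'.
by rewrite -(cat_take_drop r (X :: Xs)) foldl_cat r0 foldl_Fmap_set0.
Qed.

Lemma connected_refl e : connected f B e e. Proof. by left. Qed.

Lemma connected_trans e e' e'' :
  connected f B e e' -> connected f B e' e'' -> connected f B e e''.
Proof.
move=> /connectedE[Xs Xse'] /connectedE[Ys Yse'']; apply/connectedE.
exists (Xs ++ Ys); rewrite foldl_cat; move: Yse''; apply: foldl_Fmap_mono.
by move=> _ ->.
Qed.

(** Reversing a chain requires each of its vectors to be nonzero, because the
    construction discards 0: this is carried along the induction. *)
Lemma connected_sym e e' : e <> 0 -> connected f B e e' -> connected f B e' e.
Proof.
move=> e0 /connectedE[Xs Xse'].
suff [//] : connected f B e' e /\ e' <> 0.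
elim/last_ind: Xs e' Xse' => [|Xs X IHXs] e' /=.
  by move=> ->; split=> //; exact: connected_refl.
rewrite foldl_rcons => /Fmap_point[u /IHXs[ue u0] ue']; split; last by case: ue'.
apply: connected_trans ue; apply/connectedE; exists [:: swap_bar X].
exact: Fmap_swap_bar.
Qed.

(** The value v = f e is one plain step from e i, through the other entries, and
    e j is one barred step from v, since putting e j back at its place gives v. *)
Lemma connected_of_value_neq0 (e : {ffun 'I_n -> V}) i j :
  (forall i, B (e i)) -> e j <> 0 -> f e <> 0 -> connected f B (e i) (e j).
Proof.
move=> Be ej0 fe0; apply/connectedE.
pose xi k l : set_type B := exist _ (e (lift k l)) (mem_set (Be (lift k l))).
have fxi k : f (insert_at k (e k) (fun l => val (xi k ((1%g : 'S_n.-1) l)))) = f e.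
  rewrite -[in RHS](insert_at_lift k e); congr (f (insert_at k (e k) _)).
  by apply/funext => l; rewrite perm1.
exists [:: (fun l => inl (xi i l)); (fun l => inr (xi j l))] => /=.
apply/Fmap_point; exists (f e).
  by split=> //; left; exists (xi i) => //; exists i, 1%g, (e i).
by split=> //; right; exists (xi j) => //; exists j, 1%g; exact: fxi.
Qed.

(** * Linked classes and the overbraced subspaces *)
Hypothesis hB : is_basis B.

Definition class_of (e : V) : set V := eq_class B (connected f B) e.

Lemma class_ofP e e' : B e -> B e' ->
  class_of e = class_of e' <-> connected f B e e'.
Proof.
apply: eq_class_eqP => [x _|x y Bx _|x y z _ _ _]; first exact: connected_refl.
  exact/connected_sym/(basis_neq0 hB).
exact: connected_trans.
Qed.

Lemma class_of_basis e : B e -> basis_classes f B (class_of e).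
Proof. by move=> Be; exists e. Qed.

Lemma class_ofE c : basis_classes f B c -> c = [set e | B e /\ class_of e = c].
Proof.
move=> [e0 Be0 <-]; apply/seteqP; split=> e.
  by move=> [Be e0e]; split=> //; apply/esym/class_ofP.
by move=> [Be ee0]; split=> //; apply/class_ofP.
Qed.

Lemma VclassE (c : set V) : Vclass c = span c.
Proof.
apply: eq_span => [v [e ce]|e ce].
  by apply: span_sub v; [exact: span_subspace | move=> _ ->; exact: sub_span].
by apply: sub_span; exists e => //; exact: sub_span.
Qed.

(** Chains for approx are chains of classes, but their ends are compared as
    subspaces; this is what allows two chains to be glued. *)
Lemma Vclass_inj c d : basis_classes f B c -> basis_classes f B d ->
  Vclass c = Vclass d -> c = d.
Proof.
rewrite !VclassE => cB dB cd.
suff sub (c' d' : set V) : basis_classes f B c' -> basis_classes f B d' ->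
    span c' = span d' -> c' `<=` d'.
  by apply/seteqP; split; apply: sub.
move=> c'B d'B c'd' e c'e; apply: (span_basis_mem hB).
- by rewrite (class_ofE d'B) => ? [].
- by move: c'e; rewrite (class_ofE c'B) => -[].
by rewrite -c'd'; exact: sub_span.
Qed.

Lemma Vclass_labelled c : basis_classes f B c ->
  Vclass c = span [set e | B e /\ class_of e = c].
Proof. by move=> cB; rewrite VclassE {1}(class_ofE cB). Qed.

Lemma coordinate_Vproj c v e :
  coordinate B (Vproj f B c v) e =
  if class_of e == c then coordinate B v e else 0.
Proof.
exact: (coordinate_projection hB class_of_basis Vclass_labelled).
Qed.

Definition brace_of (e : V) : set (set V) :=
  eq_class (Vfamily f B) (approx f B) (Vclass (class_of e)).

Lemma linked_sym c d : linked f B c d -> linked f B d c.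
Proof.
have addC (W1 W2 : set V) : subspace_add W1 W2 = subspace_add W2 W1.
  apply/seteqP; split=> _ [x Wx [y Wy <-]]; exists y => //; exists x => //;
    exact: addrC.
rewrite /linked => lcd ldc; apply: lcd; rewrite -ldc.
by congr (subspace_sum _ _); apply/funext => k; exact: addC.
Qed.

Lemma approx_sym W W' : approx f B W W' -> approx f B W' W.
Proof.
case=> [->|[m [xi [xiB xi0 xim xil]]]]; [by left|right].
exists m, (fun r => xi (m - r)%N); rewrite subn0 subnn; split=> // r rm.
  by apply: xiB; exact: leq_subr.
have -> : (m - r = (m - r.+1).+1)%N by rewrite subnSK.
by apply/linked_sym/xil; rewrite ltn_subrL (leq_ltn_trans _ rm).
Qed.

Lemma approx_trans W W' W'' :
  approx f B W W' -> approx f B W' W'' -> approx f B W W''.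
Proof.
case=> [->//|[m [xi [xiB xi0 xim xil]]]] [<-|]; first by right; exists m, xi.
move=> [p [th [thB th0 thp thl]]]; right.
have glue : xi m = th 0%N.
  by apply: Vclass_inj; [exact: xiB | exact: thB | rewrite xim th0].
exists (m + p)%N, (fun r => if (r <= m)%N then xi r else th (r - m)%N).
split=> [r rmp||| r rmp] //.
- case: leqP => [|mr]; first exact: xiB.
  by apply: thB; rewrite leq_subLR.
- case: leqP => [|_]; last by rewrite addKn.
  rewrite -{2}[m]addn0 leq_add2l leqn0 => /eqP p0.
  by rewrite p0 addn0 glue -thp p0.
have [rm|mr] := ltnP r m; first by rewrite (ltnW rm); exact: xil.
have -> : (if (r <= m)%N then xi r else th (r - m)%N) = th (r - m)%N.
  case: leqP => // rm; have -> : r = m by apply/eqP; rewrite eqn_leq rm.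
  by rewrite subnn.
by rewrite subSn //; apply: thl; rewrite ltn_subLR.
Qed.

Lemma Vfamily_class_of e : B e -> Vfamily f B (Vclass (class_of e)).
Proof. by move=> Be; exists (class_of e) => //; exact: class_of_basis. Qed.

Lemma brace_ofP e e' : B e -> B e' ->
  brace_of e = brace_of e' <->
  approx f B (Vclass (class_of e)) (Vclass (class_of e')).
Proof.
move=> Be Be'; apply: eq_class_eqP; try exact: Vfamily_class_of.
- by left.
- by move=> *; exact: approx_sym.
by move=> W W' W'' _ _ _; exact: approx_trans.
Qed.

Lemma brace_of_approx_classes e : B e -> approx_classes f B (brace_of e).
Proof. by move=> Be; exists (Vclass (class_of e)) => //; exact: Vfamily_class_of. Qed.

(** An overbraced subspace is a sum of spans of classes, hence the span of the
    union of these classes, which are exactly those labelled C. *)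
Lemma overbrace_labelled C : approx_classes f B C ->
  overbrace C = span [set e | B e /\ brace_of e = C].
Proof.
move=> [_ [_ [e0 Be0 <-] <-] <-]; rewrite -/(class_of e0) -/(brace_of e0).
apply: eq_span => [v [_ [[_ [e1 Be1 <-] <-] e01]]|e [Be ee0]].
  rewrite /= (Vclass_labelled (class_of_basis Be1)); apply: span_sub v.
    exact: span_subspace.
  move=> e [Be ee1]; apply: sub_span; split=> //; apply/esym/brace_ofP => //.
  by rewrite ee1.
apply: sub_span; exists (Vclass (class_of e)).
  split; first exact: Vfamily_class_of.
  by apply/brace_ofP.
by rewrite /= (Vclass_labelled (class_of_basis Be)); exact: sub_span.
Qed.

(** The entries at positions 0 and 1 put f e in the span used to define linked;
    its projection to the class of e' is nonzero as it keeps the coordinate at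
    e'. *)
Lemma linked_of_value (e : {ffun 'I_n -> V}) c e' : (1 < n)%N ->
  (forall i, c (e i)) -> coordinate B (f e) e' <> 0 ->
  linked f B c (class_of e').
Proof.
move=> hn ec fe'.
pose k := (Ordinal (ltnW hn), Ordinal hn) : 'I_n * 'I_n.
have Vproj0 d : Vproj f B d 0 = 0.
  apply: (coordinate_inj hB) => e1.
  by rewrite coordinate_Vproj coordinate0 //; case: ifP.
(* The summand of the pair (0, 1) contains 0 plus the projection of f e. *)
rewrite /linked; set S := subspace_sum _ _ => S0.
suff : S (Vproj f B (class_of e') (f e)).
  rewrite S0 => proj0; apply: fe'.
  have := coordinate_Vproj (class_of e') (f e) e'.
  by rewrite eqxx proj0 coordinate0.
apply: sub_span; exists k => //=; exists 0.
  by exists 0; [exact: (span_subspace _).1 | exact: Vproj0].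
exists (Vproj f B (class_of e') (f e)); last by rewrite add0r.
exists (f e) => //; apply: sub_span; exists e => //.
by rewrite VclassE; split; exact: sub_span.
Qed.

End Connection.

Theorem theorem2p13 (F : fieldType) (V : lmodType F) (n : nat) (hn : (1 < n)%N)
    (f : {ffun 'I_n -> V} -> V) (hf : multilinear f)
    (B : set V) (hB : is_basis B) :
  f_orthogonal_direct_sum f (approx_classes f B) (@overbrace F V) /\
  (forall C : set (set V), approx_classes f B C ->
     strongly_invariant f (overbrace C)).
Proof.
have braceE := overbrace_labelled hB (f := f).
have braceJ := @brace_of_approx_classes _ _ _ f B.
have spanB v : span B v by rewrite hB.2.
have same_class (e : {ffun 'I_n -> V}) i j : (forall i, B (e i)) ->
    f e <> 0 -> class_of f B (e i) = class_of f B (e j).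
  move=> Be fe0; apply/(class_ofP f hB) => //.
  by apply: connected_of_value_neq0 => //; exact: basis_neq0 hB _ _.
split; [split|].
- exact: (labelled_direct_sum hB braceJ braceE).
- move=> C D hC hD CD i j ij; apply/seteqP; split; last first.
    by move=> _ ->; exact: (span_subspace _).1.
  apply: span_sub; first exact: subspace_set0.
  move=> _ [v [Cvi Dvj] <-].
  pose S l := if l == i then [set e | B e /\ brace_of f B e = C] else
              if l == j then [set e | B e /\ brace_of f B e = D] else B.
  apply: (multilinear_span hf (S := S)); first exact: subspace_set0.
    move=> e eS; have Be l : B (e l).
      by have := eS l; rewrite /S; case: ifP => _; [case|case: ifP => _; [case|]].
    apply: contrapT => fe0; apply: CD.
    have [_ <-] : B (e i) /\ brace_of f B (e i) = C.
      by have := eS i; rewrite /S eqxx.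
    have [_ <-] : B (e j) /\ brace_of f B (e j) = D.
      by have := eS j; rewrite /S eqxx; case: eqP => // ji; case: ij.
    by rewrite /brace_of (same_class e i j).
  move=> l; rewrite /S; case: eqP => [->|_]; first by rewrite -braceE.
  by case: eqP => [->|_]; [rewrite -braceE|exact: spanB].
move=> C hC i; apply: span_sub; first by rewrite braceE //; exact: span_subspace.
move=> _ [v Cvi <-].
pose S l := if l == i then [set e | B e /\ brace_of f B e = C] else B.
apply: (multilinear_span hf (S := S)).
- by rewrite braceE //; exact: span_subspace.
- move=> e eS; have Be l : B (e l).
    by have := eS l; rewrite /S; case: ifP => _; [case|].
  have [_ eiC] : B (e i) /\ brace_of f B (e i) = C.
    by have := eS i; rewrite /S eqxx.
  apply/(labelled_subspaceP hB braceE _ hC) => e' fe'.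
  have Be' := coordinate_neq0 hB fe'.
  have fe0 : f e <> 0 by move=> fe0; apply: fe'; rewrite fe0 coordinate0.
  rewrite -eiC; apply/esym/(brace_ofP f hB) => //; right.
  exists 1%N, (fun r => if r is 0 then class_of f B (e i) else class_of f B e').
  split=> //; first by case=> [|r] _; exact: class_of_basis.
  case=> // _; apply: (linked_of_value hB hn) fe' => l.
  by rewrite -(same_class e l i) //; split=> //; exact: connected_refl.
move=> l; rewrite /S; case: eqP => [->|_]; last exact: spanB.
by rewrite -braceE.
Qed.
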